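(* Let $\mathscr{C}$ be a Fraïssé class satisfying condition $(\dag)$ and the one-point homomorphism extension property (1PHEP), and let $F$ be the Fraïssé limit of $\mathscr{C}$. If the coproduct of countably infinitely many copies of $F$ exists and belongs to $\overline{\mathscr{C}}$, then the endomorphism monoid $\mathrm{End}(F)$ is strongly distorted and its Sierpiński rank is at most $3$. If, in addition, $\mathrm{End}(F)$ is not finitely generated, then $\mathrm{End}(F)$ has the (semigroup) Bergman property.
   Context: Fraïssé classes. Structures are first-order structures over a fixed countable signature. A Fraïssé class $\mathscr{C}$ is a class of finitely generated structures, countable up to isomorphism, closed under taking (isomorphic copies of) finitely generated substructures, with the joint embedding property and the amalgamation property. $\overline{\mathscr{C}}$ denotes the class of all countable structures all of whose finitely generated substructures are isomorphic to members of $\mathscr{C}$. The Fraïssé limit of $\mathscr{C}$ is the unique (up to isomorphism) countable structure $F$ that is ultrahomogeneous (every isomorphism between finitely generated substructures of $F$ extends to an automorphism of $F$) and whose finitely generated substructures are, up to isomorphism, exactly the members of $\mathscr{C}$. Amalgamated free sums and $(\dag)$. An amalgam $(A,B,C,f_1,f_2)$ consists of structures $A,B,C$ and embeddings $f_1:A\to B$, $f_2:A\to C$. Its amalgamated free sum $B\ast_A C$ is a structure $P$ with embeddings $i_1:B\to P$, $i_2:C\to P$ such that $i_1f_1=i_2f_2$ and $(P,i_1,i_2)$ is the pushout of $f_1,f_2$: for every $Q\in\overline{\mathscr{C}}$ and homomorphisms $j_1:B\to Q$, $j_2:C\to Q$ with $j_1f_1=j_2f_2$ there is a unique homomorphism $h:P\to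 Q$ with $j_1=hi_1$, $j_2=hi_2$. Condition $(\dag)$: for any amalgam $(A,B,C,f_1,f_2)$ with $A\in\mathscr{C}$ and $B,C\in\overline{\mathscr{C}}$, the amalgamated free sum $B\ast_A C$ exists and belongs to $\overline{\mathscr{C}}$. 1PHEP. A structure $C$ is a one-point extension of its substructure $B$ if there is $x\in C\setminus B$ such that $C$ is generated by $B\cup\{x\}$. $\mathscr{C}$ has the 1PHEP if for any $B,B',C\in\mathscr{C}$ such that $C$ is a one-point extension of $B$, any surjective homomorphism $\varphi:B\to B'$ can be extended to a homomorphism $\varphi':C\to C'$ for some $C'\in\mathscr{C}$ containing $B'$ as a substructure. Coproducts. The coproduct of a family $\{A_i: i\in I\}$ is a structure $S\in\overline{\mathscr{C}}$ together with embeddings $\iota_i:A_i\to S$ such that for any $B\in\overline{\mathscr{C}}$ and homomorphisms $\varphi_i:A_i\to B$ ($i\in I$) there is a unique homomorphism $\varphi:S\to B$ with $\varphi\iota_i=\varphi_i$ for all $i\in I$. Semigroup notions. $\langle A\rangle$ is the subsemigroup generated by $A$, and $A^n=\{a_1\cdots a_n: a_1,\dots,a_n\in A\}$. A semigroup $S$ has the (semigroup) Bergman property if for every generating set $A$ of $S$ there is $m\ge 1$ with $S=\bigcup_{n=1}^m A^n$. The Sierpiński rank of $S$ is the least positive integer $n$ such that for every countable $A\subseteq S$ there exist $s_1,\dots,s_n\in S$ with $A\subseteq\langle s_1,\dots,s_n\rangle$ (infinite if no such $n$ exists). $S$ is strongly distorted if there exist a sequence of natural numbers $(\ell_n)_{n<\omega}$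 and $M<\omega$ such that for any sequence $(a_n)_{n<\omega}$ of elements of $S$ there exist $s_1,\dots,s_M\in S$ and words $(\mathbf{w}_n)_{n<\omega}$ over an $M$-letter alphabet with $|\mathbf{w}_n|\le\ell_n$ and $a_n=\mathbf{w}_n(s_1,\dots,s_M)$ for all $n<\omega$. *)

(* Defs.v *)
From HB Require Import structures.
From mathcomp Require Import all_boot.
From mathcomp Require Import boolp classical_sets functions cardinality.

Set Implicit Arguments.
Unset Strict Implicit.
Unset Printing Implicit Defensive.

Local Open Scope classical_set_scope.

(* Constants are the function symbols of arity 0. *)
Record signature := Signature {
  fsym : countType;
  farity : fsym -> nat;
  rsym : countType;
  rarity : rsym -> nat }.

(* Structures are nonempty, so in a language without constants the empty set
   does not carry a substructure. *)
Record structure (L : signature) := Structure {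
  carrier :> Type;
  carrier_neq0 : [set: carrier] !=set0;
  fint : forall f : fsym L, ('I_(farity f) -> carrier) -> carrier;
  rint : forall r : rsym L, ('I_(rarity r) -> carrier) -> Prop }.
Arguments fint {L} _ f _.
Arguments rint {L} _ r _.

Record hom (L : signature) (A B : structure L) := Hom {
  hom_fun :> A -> B;
  hom_fint : forall f x, hom_fun (fint A f x) = fint B f (hom_fun \o x);
  hom_rint : forall r x, rint A r x -> rint B r (hom_fun \o x) }.

Definition is_embedding (L : signature) (A B : structure L) (h : hom A B) :=
  injective h /\ forall r x, rint B r (h \o x) -> rint A r x.

Definition is_iso (L : signature) (A B : structure L) (h : hom A B) :=
  is_embedding h /\ range h = [set: B].

Definition isomorphic (L : signature) (A B : structure L) :=
  exists h : hom A B, is_iso h.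

Definition op_closed (L : signature) (A : structure L) (X : set A) :=
  forall (f : fsym L) (x : 'I_(farity f) -> A),
    (forall i, X (x i)) -> X (fint A f x).

Record substructure (L : signature) (A : structure L) := Substructure {
  members :> set A;
  members_neq0 : members !=set0;
  members_closed : op_closed members }.

Section Induced.
Variables (L : signature) (A : structure L) (U : substructure A).

Lemma induced_neq0 : [set: {a : A | members U a}] !=set0.
Proof. by have [a Ua] := members_neq0 U; exists (exist _ a Ua). Qed.

Definition induced : structure L := {|
  carrier := {a : A | members U a};
  carrier_neq0 := induced_neq0;
  fint := fun f x =>
    exist _ _ (@members_closed _ _ U f (sval \o x) (fun i => svalP (x i)));
  rint := fun r x => rint A r (sval \o x) |}.
End Induced.

Definition generated (L : signature) (A : structure L) (X : set A) : set A :=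
  smallest (@op_closed L A) X.

Definition fin_gen (L : signature) (A : structure L) :=
  exists X : set A, finite_set X /\ generated X = [set: A].

(* A class of L-structures is a predicate [C : structure L -> Prop]; closure
   under isomorphism is part of [hereditary]. *)

Definition countable_up_to_iso (L : signature) (C : structure L -> Prop) :=
  exists D : nat -> structure L, forall A, C A -> exists n, isomorphic A (D n).

Definition hereditary (L : signature) (C : structure L -> Prop) :=
  forall B : structure L, C B -> forall U : substructure B,
    fin_gen (induced U) -> forall A, isomorphic A (induced U) -> C A.

Definition joint_embedding (L : signature) (C : structure L -> Prop) :=
  forall A B, C A -> C B -> exists D : structure L,
    C D /\ exists (i : hom A D) (j : hom B D), is_embedding i /\ is_embedding j.

Definition amalgamation (L : signature) (C : structure L -> Prop) :=
  forall A B1 B2 (f1 : hom A B1) (f2 : hom A B2), C A -> C B1 -> C B2 ->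
    is_embedding f1 -> is_embedding f2 ->
    exists D : structure L, C D /\ exists (g1 : hom B1 D) (g2 : hom B2 D),
      [/\ is_embedding g1, is_embedding g2 & g1 \o f1 =1 g2 \o f2].

Definition fraisse_class (L : signature) (C : structure L -> Prop) :=
  [/\ forall A, C A -> fin_gen A, countable_up_to_iso C, hereditary C,
      joint_embedding C & amalgamation C].

Definition closure_class (L : signature) (C : structure L -> Prop)
    (S : structure L) :=
  countable [set: S] /\
  forall U : substructure S, fin_gen (induced U) ->
    exists A, C A /\ isomorphic (induced U) A.

Definition ultrahomogeneous (L : signature) (F : structure L) :=
  forall U V : substructure F, fin_gen (induced U) -> fin_gen (induced V) ->
  forall g : hom (induced U) (induced V), is_iso g ->
  exists h : hom F F, is_iso h /\ forall u, h (sval u) = sval (g u).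

Definition fraisse_limit (L : signature) (C : structure L -> Prop)
    (F : structure L) :=
  [/\ countable [set: F], ultrahomogeneous F,
      forall U : substructure F, fin_gen (induced U) ->
        exists A, C A /\ isomorphic (induced U) A
    & forall A, C A -> exists U : substructure F,
        fin_gen (induced U) /\ isomorphic A (induced U)].

Definition is_amalgamated_free_sum (L : signature) (C : structure L -> Prop)
    (A B1 B2 : structure L) (f1 : hom A B1) (f2 : hom A B2)
    (P : structure L) (i1 : hom B1 P) (i2 : hom B2 P) :=
  [/\ is_embedding i1, is_embedding i2, i1 \o f1 =1 i2 \o f2
    & forall Q, closure_class C Q ->
      forall (j1 : hom B1 Q) (j2 : hom B2 Q), j1 \o f1 =1 j2 \o f2 ->
      exists! h : hom P Q, h \o i1 =1 j1 /\ h \o i2 =1 j2].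

Definition dagger (L : signature) (C : structure L -> Prop) :=
  forall (A B1 B2 : structure L) (f1 : hom A B1) (f2 : hom A B2),
    C A -> closure_class C B1 -> closure_class C B2 ->
    is_embedding f1 -> is_embedding f2 ->
    exists (P : structure L) (i1 : hom B1 P) (i2 : hom B2 P),
      is_amalgamated_free_sum C f1 f2 i1 i2 /\ closure_class C P.

Definition one_point_extension (L : signature) (C : structure L)
    (B : substructure C) :=
  exists x : C, ~ members B x /\ generated (B `|` [set x]) = [set: C].

(* That D' contains B' as a substructure is witnessed by an embedding of B'
   into D'. *)
Definition one_point_hom_ext (L : signature) (C : structure L -> Prop) :=
  forall (D : structure L) (B : substructure D) (B' : structure L),
    C (induced B) -> C B' -> C D -> one_point_extension B ->
    forall phi : hom (induced B) B', range phi = [set: B'] ->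
    exists (D' : structure L) (e : hom B' D') (phi' : hom D D'),
      [/\ C D', is_embedding e & forall b, phi' (sval b) = e (phi b)].

Definition is_coproduct (L : signature) (C : structure L -> Prop) (I : Type)
    (A : I -> structure L) (S : structure L) (iota : forall i, hom (A i) S) :=
  [/\ closure_class C S, forall i, is_embedding (iota i)
    & forall B, closure_class C B -> forall phi : forall i, hom (A i) B,
      exists! h : hom S B, forall i, h \o iota i =1 phi i].

Lemma hom_ext (L : signature) (A B : structure L) (g h : hom A B) :
  g =1 h -> g = h.
Proof.
case: g h => [g gF gR] [h hF hR] /= /funext gh.
by case: _ / gh in hF hR *; congr Hom; exact: Prop_irrelevance.
Qed.

Section Endomorphisms.
Variables (L : signature) (F : structure L).

Definition End := hom F F.

HB.instance Definition _ := gen_eqMixin End.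
HB.instance Definition _ := gen_choiceMixin End.

Lemma comp_fint (g h : End) f x :
  (g \o h) (fint F f x) = fint F f ((g \o h) \o x).
Proof. by rewrite /= !hom_fint. Qed.

Lemma comp_rint (g h : End) r x : rint F r x -> rint F r ((g \o h) \o x).
Proof. by move=> /(hom_rint h)/(hom_rint g). Qed.

Definition end_mul (g h : End) : End := Hom (@comp_fint g h) (@comp_rint g h).
Definition end_one : End :=
  @Hom L F F idfun (fun f x => erefl (fint F f x)) (fun r x (Rx : rint F r x) => Rx).

Lemma end_mulA : associative end_mul. Proof. by move=> g h k; apply: hom_ext. Qed.
Lemma end_mul1g : left_id end_one end_mul. Proof. by move=> g; apply: hom_ext. Qed.
Lemma end_mulg1 : right_id end_one end_mul. Proof. by move=> g; apply: hom_ext. Qed.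

HB.instance Definition _ := isMonoid.Build End end_mulA end_mul1g end_mulg1.
End Endomorphisms.

Definition sg_generated (S : semigroupType) (A : set S) : set S :=
  smallest (fun T : set S => forall x y, T x -> T y -> T (x * y)%g) A.

(* Semigroup words are nonempty: [(x, w)] stands for the word x :: w. *)
Definition word (X : Type) : Type := X * seq X.

Definition word_length (X : Type) (w : word X) : nat := (size w.2).+1.

Definition word_eval (S : semigroupType) (X : Type) (s : X -> S) (w : word X) : S :=
  foldl (fun p x => (p * s x)%g) (s w.1) w.2.

(* The set A^n of all products of n elements of A; it is empty for n = 0. *)
Definition sg_power (S : semigroupType) (A : set S) (n : nat) : set S :=
  [set word_eval id w | w in [set w : word S |
    word_length w = n /\ forall a, a \in w.1 :: w.2 -> A a]].

Definition sg_fin_gen (S : semigroupType) :=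
  exists A : set S, finite_set A /\ sg_generated A = [set: S].

Definition bergman (S : semigroupType) :=
  forall A : set S, sg_generated A = [set: S] ->
  exists m : nat, 1 <= m /\
    [set: S] = \bigcup_(n in [set n | 1 <= n <= m]) sg_power A n.

Definition covers_countable (S : semigroupType) (n : nat) :=
  forall A : set S, countable A ->
  exists s : 'I_n -> S, A `<=` sg_generated (range s).

(* The rank is finite iff some n satisfies this predicate. *)
Definition is_sierpinski_rank (S : semigroupType) (n : nat) :=
  [/\ 0 < n, covers_countable S n
    & forall k, 0 < k -> covers_countable S k -> n <= k].

Definition strongly_distorted (S : semigroupType) :=
  exists (l : nat -> nat) (M : nat), forall a : nat -> S,
  exists (s : 'I_M -> S) (w : nat -> word 'I_M),
  forall n, word_length (w n) <= l n /\ a n = word_eval s (w n).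

(* Main.v *)
(* Let S be the coproduct of the copies iota_n of F. There is a homomorphism
   e : S -> F along which every homomorphism S -> F extends to an endomorphism
   of F. Granted this, let sigma be the shift of S (sigma iota_n = iota_(n+1))
   and let [shift] extend e sigma along e. For endomorphisms a_n of F, let beta
   extend along e the homomorphism S -> F with components a_n. Then
   a_n = beta shift^n (e iota_0), a word of length n + 2 in three letters. This
   is strong distortion with M = 3, which bounds the Sierpinski rank by 3 and
   implies the Bergman property.

   To find e, write S and F as increasing unions of finitely generated X_n and
   Y_n, with embeddings e_n : X_n -> Y_n, such that X_(n+1) and Y_n sit in
   Y_(n+1) as in the amalgamated free sum of Y_n and S over X_n. Given S -> F, a
   compatible homomorphism Y_n -> F extends to the free sum by universality,
   and from there to Y_(n+1), one more point, by the 1PHEP. Only finitely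
   generated pieces are embedded into F, so neither a colimit nor the uniqueness
   of the Fraisse limit is needed. *)
Require Import Defs.
From mathcomp Require Import all_boot.
From mathcomp Require Import boolp classical_sets functions cardinality.

Set Implicit Arguments.
Unset Strict Implicit.
Unset Printing Implicit Defensive.

Local Open Scope classical_set_scope.

Lemma countable_surj (T : Type) (A : set T) :
  countable A -> A !=set0 -> exists f : nat -> T, A `<=` range f.
Proof.
move=> cA [a0 _]; have /pfcard_geP[->|[f]] := cA; first by exists (fun=> a0).
by exists f => a /(@surj _ _ _ _ f)[n _ <-]; exists n.
Qed.

(** * Distortion in semigroups *)

Section Distortion.
Variable S : semigroupType.
Implicit Types A : set S.

Lemma sg_power1 A x : A x -> sg_power A 1 x.
Proof. by move=> Ax; exists (x, [::]) => //; split=> // a; rewrite inE => /eqP->. Qed.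

Lemma foldl_mul (X : Type) (s : X -> S) (p q : S) (w : seq X) :
  foldl (fun r x => (r * s x)%g) (p * q)%g w =
  (p * foldl (fun r x => (r * s x)%g) q w)%g.
Proof. by elim: w q => //= x w IH q; rewrite -IH mulgA. Qed.

Lemma sg_powerM A m n x y :
  sg_power A m x -> sg_power A n y -> sg_power A (m + n) (x * y)%g.
Proof.
move=> [[a u] [<- Au] <-] [[b v] [<- Av] <-].
exists (a, u ++ b :: v).
  split=> [|c]; first by rewrite /word_length /= size_cat /= addSn.
  by rewrite -cat_cons mem_cat => /orP[/Au|/Av].
by rewrite /word_eval foldl_cat /= foldl_mul.
Qed.

Lemma sg_generated_power A x :
  sg_generated A x -> exists n, 0 < n /\ sg_power A n x.
Proof.
apply: (@smallest_sub _ _ _ [set x | exists n, 0 < n /\ sg_power A n x]) => [a b|a Aa].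
  move=> [m [m0 Am]] [n [n0 An]]; exists (m + n); split; first exact: ltn_addr.
  exact: sg_powerM.
by exists 1; split=> //; exact: sg_power1.
Qed.

Lemma word_eval_generated (X : Type) (s : X -> S) (w : word X) :
  sg_generated (range s) (word_eval s w).
Proof.
case: w => x w; rewrite /word_eval /=.
have gs y : sg_generated (range s) (s y) by apply: sub_gen_smallest; exists y.
elim/last_ind: w => [|w y IH] /=; first exact: gs.
by rewrite foldl_rcons => T [cT sT]; apply: (cT); [exact: IH|exact: gs].
Qed.

Lemma word_eval_power A (X : Type) (s : X -> S) (K : nat) :
    (forall x, exists2 k, 0 < k <= K & sg_power A k (s x)) ->
  forall w, exists2 k, 0 < k <= word_length w * K & sg_power A k (word_eval s w).
Proof.
move=> As [x w]; rewrite /word_length /word_eval /=.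
elim/last_ind: w => [|w y [k /andP[k0 kK] Ak]] /=; first by rewrite mul1n; exact: As.
have [j /andP[j0 jK] Aj] := As y; exists (k + j).
  by rewrite ltn_addr //= size_rcons mulSn addnC leq_add.
by rewrite foldl_rcons; exact: sg_powerM.
Qed.

(* If no power of A exhausts S, some a_n needs more than n * l_n factors
   from A; but the a_n are words of length at most l_n over finitely many
   elements, each of which has bounded length K over A: absurd for n = K. *)
Lemma strongly_distorted_bergman : strongly_distorted S -> bergman S.
Proof.
move=> [l [M dist]] A genA; apply: contrapT => unb.
have far n : exists a, forall k, 0 < k <= n -> ~ sg_power A k a.
  (* The bound has to be at least 1, while [n] may be 0. *)
  apply: contrapT => /forallNP all_n; apply: unb; exists n.+1; split=> //.
  apply/seteqP; split=> // a _; apply: contrapT => na; apply: (all_n a).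
  move=> k /andP[k0 kn] Ak; apply: na; exists k => //=.
  by rewrite k0 leqW.
have [a afar] := choice (fun n => far (l n * n)).
have [s [w sw]] := dist a.
have len i : exists k, 0 < k /\ sg_power A k (s i).
  by apply: sg_generated_power; rewrite genA.
have [len_s slen] := choice len.
pose K := \max_i len_s i.
have lenK i : exists2 k, 0 < k <= K & sg_power A k (s i).
  have [s0 As] := slen i; exists (len_s i) => //.
  by rewrite s0 leq_bigmax.
have [k /andP[k0 kK] Ak] := word_eval_power lenK (w K).
have [wl aw] := sw K; apply: (afar K k); last by rewrite aw.
by rewrite k0 (leq_trans kK) // leq_mul2r wl orbT.
Qed.

Lemma covers_countable_words (x0 : S) (M : nat) :
  (forall a : nat -> S, exists (s : 'I_M -> S) (w : nat -> word 'I_M),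
     forall n, a n = word_eval s (w n)) -> covers_countable S M.
Proof.
move=> wordsM A cA; have [->|/set0P A0] := eqVneq A set0.
  by exists (fun=> x0).
have [a Aa] := countable_surj cA A0; have [s [w sw]] := wordsM a.
by exists s => _ /Aa[n _ <-]; rewrite sw; exact: word_eval_generated.
Qed.

Lemma sierpinski_rank_le (M : nat) : 0 < M -> covers_countable S M ->
  exists n, is_sierpinski_rank S n /\ n <= M.
Proof.
move=> M0 cM; have ex : exists n, (0 < n) && `[< covers_countable S n >].
  by exists M; rewrite M0; exact/asboolP.
case: (ex_minnP ex) => n /andP[n0 /asboolP cn] nmin.
have min k : 0 < k -> covers_countable S k -> n <= k.
  by move=> k0 ck; apply: nmin; rewrite k0; exact/asboolP.
by exists n; split; [split|exact: min].
Qed.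

End Distortion.

(** * Substructures and partial homomorphisms *)

Section Structures.
Variable L : signature.
Implicit Types A B D : structure L.

(** Transparent, so that applying the composite computes to iterated application. *)
Definition hom_comp A B D (g : hom B D) (h : hom A B) : hom A D.
Proof.
exists (g \o h) => [f x|r x Rx] /=; first by rewrite !hom_fint.
exact: (hom_rint g (hom_rint h Rx)).
Defined.

Lemma hom_comp_embedding A B D (g : hom B D) (h : hom A B) :
  is_embedding g -> is_embedding h -> is_embedding (hom_comp g h).
Proof.
move=> [gI gR] [hI hR]; split; first exact: inj_comp.
by move=> r x /gR/hR.
Qed.

Definition hom_id A : hom A A :=
  @Hom L A A idfun (fun f x => erefl (fint A f x)) (fun r x (Rx : rint A r x) => Rx).

Lemma isomorphic_refl A : isomorphic A A.
Proof.
by exists (hom_id A); split; [split|apply/seteqP; split=> // a _; exists a].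
Qed.

Definition incl A (U : substructure A) : hom (induced U) A :=
  @Hom L (induced U) A sval (fun f x => erefl)
    (fun r x (Rx : rint (induced U) r x) => Rx).

Lemma incl_embedding A (U : substructure A) : is_embedding (incl U).
Proof. by split=> // -[a aU] [b bU] /= ab; exact: eq_exist. Qed.

Lemma range_closed A B (h : hom A B) : op_closed (range h).
Proof.
move=> f x hx; have /choice[y hy] i : exists a, h a = x i.
  by have [a _ <-] := hx i; exists a.
by exists (fint A f y) => //; rewrite hom_fint; congr fint; exact/funext.
Qed.

Lemma range_neq0 A B (h : hom A B) : range h !=set0.
Proof. by have [a _] := carrier_neq0 A; exists (h a), a. Qed.

Definition hom_range A B (h : hom A B) : substructure B :=
  Substructure (range_neq0 h) (@range_closed _ _ h).

Lemma hom_corestrict A B (h : hom A B) (V : substructure B) :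
    (forall a, members V (h a)) ->
  exists h' : hom A (induced V), (forall a, sval (h' a) = h a) /\
    (is_embedding h -> is_embedding h').
Proof.
move=> hV; pose k a : induced V := exist _ (h a) (hV a).
have kF f x : k (fint A f x) = fint (induced V) f (k \o x).
  by apply: eq_exist; rewrite hom_fint.
have kR r x : rint A r x -> rint (induced V) r (k \o x) by move/(hom_rint h).
exists (Hom kF kR); split=> // -[hI hR]; split; last by move=> r x /hR.
by move=> a b /(congr1 sval)/hI.
Qed.

(** The last clause evaluates the inverse at a point of the range whatever its membership proof
    is. *)
Lemma embedding_inverse A B (h : hom A B) : is_embedding h ->
  exists g : hom (induced (hom_range h)) A,
    [/\ is_iso g, forall v, h (g v) = sval v & forall v a, sval v = h a -> g v = a].
Proof.
move=> [hI hR].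
have /choice[g hg] (v : induced (hom_range h)) : exists a, h a = sval v.
  by have [a _ ha] := svalP v; exists a.
have hgx n (x : 'I_n -> _) : h \o (g \o x) = sval \o x by apply/funext => i; exact: hg.
have gF f x : g (fint _ f x) = fint A f (g \o x).
  by apply: hI; rewrite hg hom_fint hgx.
have gR r x : rint _ r x -> rint A r (g \o x).
  by move=> Rx; apply: hR; rewrite hgx.
have gE v a : sval v = h a -> g v = a by rewrite -hg => /hI.
exists (Hom gF gR); split=> //; split; first split.
- move=> v v' /= vv'; have := congr1 h vv'; rewrite !hg.
  by case: v v' {vv'} => [v vU] [v' v'U] /= vv'; exact: eq_exist.
- by move=> r x /= /(hom_rint h); rewrite hgx.
- apply/seteqP; split=> // a _.
  have ha : members (hom_range h) (h a) by exists a.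
  by exists (exist _ (h a) ha) => //=; exact: gE.
Qed.

Lemma generated_closed A (X : set A) : op_closed (generated X).
Proof. by move=> f x Xx T TX; apply: TX.1 => i; exact: Xx. Qed.

Lemma generated_mono A (X Y : set A) :
  X `<=` Y -> generated X `<=` generated Y.
Proof. by apply: sub_smallest2r; exact: generated_closed. Qed.

Lemma generated_hom A B (h : hom A B) (X : set A) (Y : set B) :
  op_closed Y -> (forall a, X a -> Y (h a)) -> forall a, generated X a -> Y (h a).
Proof.
move=> cY XY; apply: (@smallest_sub _ _ _ [set a | Y (h a)]) => // f x hx.
by rewrite /= hom_fint; exact: cY.
Qed.

Lemma generated_image A B (h : hom A B) (X : set A) :
  h @` generated X = generated (h @` X).
Proof.
apply/seteqP; split.
  move=> _ [a Xa <-]; apply: (generated_hom (X := X)) => //.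
    exact: generated_closed.
  by move=> b Xb; apply: sub_gen_smallest; exists b.
apply: smallest_sub => [f x hx|_ [a Xa <-]].
  have /choice[y hy] i : exists a, generated X a /\ h a = x i.
    by have [a Xa <-] := hx i; exists a.
  exists (fint A f y); first by apply: generated_closed => i; have [] := hy i.
  by rewrite hom_fint; congr fint; apply/funext => i; have [] := hy i.
by exists a => //; exact: sub_gen_smallest.
Qed.

(** Finite generation stated inside the ambient structure. Such a set is empty if there are neither
    generators nor constants, so nonemptiness is carried separately. *)
Definition fg_set A (X : set A) := exists G, finite_set G /\ X = generated G.

Lemma fg_set_closed A (X : set A) : fg_set X -> op_closed X.
Proof. by move=> [G [_ ->]]; exact: generated_closed. Qed.

Lemma fg_setU1 A (X : set A) a : fg_set X -> fg_set (generated (X `|` [set a])).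
Proof.
move=> [G [Gfin ->]]; exists (G `|` [set a]); split.
  by rewrite finite_setU.
apply/seteqP; split.
  apply: smallest_sub; first exact: generated_closed.
  move=> b [|->]; first by apply: generated_mono => c; left.
  by apply: sub_gen_smallest; right.
by apply: generated_mono => c [Gc|->]; [left; exact: sub_gen_smallest|right].
Qed.

Lemma fg_range A B (h : hom A B) : fin_gen A -> fg_set (range h).
Proof.
move=> [X [Xfin genX]]; exists (h @` X); split; first exact: finite_image.
by rewrite -genX generated_image.
Qed.

Lemma fin_gen_surj A B (h : hom A B) : range h = [set: B] -> fin_gen A -> fin_gen B.
Proof. by move=> hS /(fg_range h)[G [Gfin genG]]; exists G; rewrite -genG. Qed.

Lemma fg_set_fin_gen A (U : substructure A) : fg_set U -> fin_gen (induced U).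
Proof.
move=> [G [Gfin UG]].
have G_U g : G g -> members U g by rewrite UG; exact: sub_gen_smallest.
pose GU : set (induced U) := [set u | G (sval u)]; exists GU; split.
  have [E|/set0P[g0 Gg0]] := eqVneq G set0.
    by rewrite (_ : GU = set0) // /GU E; apply/seteqP; split.
  pose lift a : induced U :=
    if pselect (members U a) is left Ua then exist _ a Ua else exist _ g0 (G_U _ Gg0).
  apply: sub_finite_set (finite_image lift Gfin) => -[u Uu] /= Gu.
  exists u => //; rewrite /lift; case: pselect => // Uu'; exact: eq_exist.
apply/seteqP; split=> // u _.
(* Generation is checked in [A]: the inclusion maps [generated GU] onto [generated G], and it is
   injective. *)
have : (incl U @` generated GU) (sval u).
  rewrite generated_image (_ : _ @` _ = G) -?UG; first exact: (svalP u).
  apply/seteqP; split=> [_ [v Gv <-] //|g Gg].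
  by exists (exist _ g (G_U _ Gg)).
by move=> [v Gv /(incl_embedding U).1 <-].
Qed.

Lemma fin_gen_fg_set A (U : substructure A) : fin_gen (induced U) -> fg_set U.
Proof.
move=> /(fg_range (incl U)); congr fg_set; apply/seteqP; split.
  by move=> _ [u _ <-]; exact: (svalP u).
by move=> a Ua; exists (exist _ a Ua).
Qed.

(* Homomorphisms on substructures are handled as total functions with junk
   values outside the substructure. *)
Definition hom_on A B (X : set A) (h : A -> B) :=
  (forall f x, (forall i, X (x i)) -> h (fint A f x) = fint B f (h \o x)) /\
  (forall r x, (forall i, X (x i)) -> rint A r x -> rint B r (h \o x)).

Definition embedding_on A B (X : set A) (h : A -> B) :=
  [/\ hom_on X h, forall a b, X a -> X b -> h a = h b -> a = b &
      forall r x, (forall i, X (x i)) -> rint B r (h \o x) -> rint A r x].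

Lemma hom_on_restrict A B (U : substructure A) (h : A -> B) : hom_on U h ->
  exists h' : hom (induced U) B, forall u, h' u = h (sval u).
Proof.
move=> [hF hR].
have h'F f x : h (sval (fint (induced U) f x)) = fint B f (h \o sval \o x).
  by rewrite hF // => i; exact: (svalP (x i)).
have h'R r x : rint (induced U) r x -> rint B r (h \o sval \o x).
  by move=> Rx; apply: (hR r (sval \o x)) => // i; exact: (svalP (x i)).
by exists (@Hom L (induced U) B (h \o sval) h'F h'R).
Qed.

Lemma hom_extend_on A B (U : substructure A) (h : hom (induced U) B) :
  exists h' : A -> B, [/\ hom_on U h', forall u, h' (sval u) = h u &
    is_embedding h -> embedding_on U h'].
Proof.
have [b _] := carrier_neq0 B.
pose h' a := if pselect (members U a) is left Ua then h (exist _ a Ua) else b.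
have h'E u : h' (sval u) = h u.
  rewrite /h'; case: pselect => [Uu|/(_ (svalP u))//].
  by congr (h _); case: u Uu => u Uu Uu'; exact: eq_exist.
pose up n (x : 'I_n -> A) (Ux : forall i, members U (x i)) i : induced U := exist _ (x i) (Ux i).
have h'x n (x : 'I_n -> A) Ux : h' \o x = h \o up n x Ux.
  by apply/funext => i /=; rewrite -h'E.
have h'U : hom_on U h'.
  split=> [f x Ux|r x Ux Rx]; rewrite (h'x _ _ Ux).
    by rewrite -hom_fint -h'E.
  exact: (hom_rint h (x := up _ x Ux)).
exists h'; split=> // -[hI hR]; split=> // [a c Ua Uc|r x Ux].
  by move: (h'E (exist _ a Ua)) (h'E (exist _ c Uc)) => /= -> -> /hI[].
by rewrite (h'x _ _ Ux) => /hR.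
Qed.

End Structures.

(** * Extending homomorphisms into a Fraïssé limit *)

Section FraisseLimit.
Variables (L : signature) (C : structure L -> Prop) (F : structure L).
Hypotheses (hC : fraisse_class C) (hF : fraisse_limit C F).

Lemma class_hereditary (A : structure L) (U : substructure A) :
  C A -> fg_set U -> C (induced U).
Proof.
case: hC => _ _ her _ _ CA /fg_set_fin_gen Ufg.
exact: her CA _ Ufg _ (isomorphic_refl _).
Qed.

(** Hereditarity is applied to the full substructure of [B]. *)
Lemma class_iso (A B : structure L) : C B -> isomorphic A B -> C A.
Proof.
case: hC => fg _ her _ _ CB [h [hemb hS]].
have full_closed : op_closed [set: B] by [].
pose U := Substructure (carrier_neq0 B) full_closed.
have [h' [h'E h'emb]] := hom_corestrict (h := h) (V := U) (fun=> I).
have Ufg : fin_gen (induced U).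
  have [k [kE _]] := hom_corestrict (h := hom_id B) (V := U) (fun=> I).
  apply: (fin_gen_surj (h := k)) (fg _ CB); apply/seteqP; split=> // -[b bU] _.
  by exists b => //; case: (k b) (kE b) => b' b'U /= ->; exact: eq_exist.
apply: (her _ CB U Ufg); exists h'; split; first exact: h'emb.
apply/seteqP; split=> // -[b bU] _.
have [a _ ab] : range h b by rewrite hS.
by exists a => //; case: (h' a) (h'E a) => b' b'U /= ->; exact: eq_exist.
Qed.

Lemma closure_class_fg (S : structure L) (U : substructure S) :
  closure_class C S -> fg_set U -> C (induced U).
Proof. by move=> [_ age] /fg_set_fin_gen/age[A [CA]]; exact: class_iso. Qed.

Lemma class_closure (A : structure L) :
  C A -> countable [set: A] -> closure_class C A.
Proof.
move=> CA cA; split=> // U /fin_gen_fg_set Ufg; exists (induced U).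
by split; [exact: class_hereditary|exact: isomorphic_refl].
Qed.

Lemma limit_closure : closure_class C F.
Proof. by case: hF. Qed.

Lemma limit_fg (U : substructure F) : fg_set U -> C (induced U).
Proof. exact: closure_class_fg limit_closure. Qed.

Lemma induced_countable (S : structure L) (U : substructure S) :
  countable [set: S] -> countable [set: induced U].
Proof.
move=> /countable_injP[f fI]; apply/countable_injP; exists (f \o sval) => u v _ _.
by move/(fI _ _ (in_setT _) (in_setT _))/(incl_embedding U).1.
Qed.

Lemma limit_embedding (D : structure L) : C D -> exists h : hom D F, is_embedding h.
Proof.
case: hF => _ _ _ univ /univ[W [_ [g [gemb _]]]].
by exists (hom_comp (incl W) g); apply: hom_comp_embedding => //; exact: incl_embedding.
Qed.

(** Embed [D] in [F] by any [g]. The image of [U] under [g \o j] is a copy of [U], and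
    ultrahomogeneity gives an automorphism [h] carrying it back to [U]; take [h \o g]. *)
Lemma limit_extension (U : substructure F) (D : structure L)
    (j : hom (induced U) D) : fg_set U -> C D -> is_embedding j ->
  exists k : hom D F, is_embedding k /\ forall u, k (j u) = sval u.
Proof.
move=> Ufg CD jemb; have [g gemb] := limit_embedding CD.
have [p [piso _ pE]] := embedding_inverse (hom_comp_embedding gemb jemb).
case: hF => _ homog _ _.
have Ufg' := fg_set_fin_gen Ufg.
have [|h [[hemb _] hE]] := homog _ U _ Ufg' _ piso.
  exact/fg_set_fin_gen/fg_range.
exists (hom_comp h g); split; first exact: hom_comp_embedding.
move=> u /=.
have gju : members (hom_range (hom_comp g j)) (g (j u)) by exists u.
by rewrite (hE (exist _ _ gju)) (pE _ u).
Qed.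

(** As a map onto its image [W], [psi] is surjective, so the 1PHEP extends it to a homomorphism from
    the structure on [Z] to some [D'] containing [W]; by [limit_extension], [D'] embeds in [F] over
    [W]. *)
Lemma hom_extend_point (h1p : one_point_hom_ext C) (Y : set F) (psi : F -> F) (x : F) :
    fg_set Y -> Y !=set0 -> hom_on Y psi ->
  exists psi' : F -> F,
    hom_on (generated (Y `|` [set x])) psi' /\ forall y, Y y -> psi' y = psi y.
Proof.
move=> Yfg Y0 psiY; set Z := generated (Y `|` [set x]).
have YZ : Y `<=` Z by move=> y Yy; apply: sub_gen_smallest; left.
(* If [x] lies in [Y], there is no new point and [psi] itself serves. *)
have [Yx|nYx] := pselect (Y x).
  exists psi; split=> //; suff -> : Z = Y by [].
  apply/seteqP; split=> //; apply: smallest_sub; first exact: fg_set_closed.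
  by move=> y [//|->].
have Z0 : Z !=set0 by have [y /YZ] := Y0; exists y.
pose U := Substructure Y0 (fg_set_closed Yfg).
pose V := Substructure Z0 (@generated_closed _ _ (Y `|` [set x])).
have Vfg : fg_set V by exact: fg_setU1.
have [iota [iotaE /(_ (incl_embedding U)) iotaemb]] :=
  hom_corestrict (h := incl U) (V := V) (fun u => YZ _ (svalP u)).
(* The 1PHEP speaks of a substructure of the larger structure, so [Y] is recast as a substructure
   [B] of the structure on [Z], and [psi] is transported along the inverse [p] of [iota]. *)
pose B := hom_range iota.
have iotaB u : members B (iota u) by exists u.
have [p [piso _ pE]] := embedding_inverse iotaemb.
have [q qE] := hom_on_restrict (U := U) psiY.
pose phi0 := hom_comp q p; pose W := hom_range phi0.
have Bfg : fg_set B by apply: fg_range; exact: fg_set_fin_gen.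
have Wfg : fg_set W by apply: fg_range; exact: fg_set_fin_gen.
have CV : C (induced V) by exact: limit_fg.
have phi0W b : members W (phi0 b) by exists b.
have [phi [phiE _]] := hom_corestrict phi0W.
have phi_onto : range phi = [set: induced W].
  apply/seteqP; split=> // w _; have [b _ bw] := svalP w; exists b => //.
  by apply: (incl_embedding W).1; rewrite /= phiE.
have xV : members V x by apply: sub_gen_smallest; right.
have ope : one_point_extension B.
  exists (exist _ x xV); split.
    move=> [u _ /(congr1 sval)]; rewrite iotaE /= => ux.
    by apply: nYx; rewrite -ux; exact: (svalP u).
  apply/seteqP; split=> // v _.
  have : (incl V @` generated (B `|` [set exist _ x xV])) (sval v).
    rewrite generated_image; apply: generated_mono (svalP v) => y [Yy|->].
      by exists (iota (exist _ y Yy)); [left|rewrite /= iotaE].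
    by exists (exist _ x xV) => //; right.
  by move=> [v' Bv' /(incl_embedding V).1 <-].
have [D' [e [phi' [CD' eemb phi'E]]]] :=
  h1p _ _ _ (class_hereditary CV Bfg) (limit_fg Wfg) CV ope _ phi_onto.
have [k [_ kE]] := limit_extension Wfg CD' eemb.
have [psi' [psi'V psi'E _]] := hom_extend_on (hom_comp k phi').
exists psi'; split=> // y Yy.
pose u : induced U := exist _ y Yy.
have uE : sval (iota u) = y := iotaE u.
rewrite -[y in LHS]uE psi'E /=.
by rewrite (phi'E (exist _ _ (iotaB u))) kE phiE /= (pE _ u) // qE.
Qed.


(** * The homomorphism from S to F, built in finitely generated stages *)

Section FreeExtension.
Hypotheses (hdag : dagger C) (h1p : one_point_hom_ext C).
Variables (S : structure L) (hS : closure_class C S).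

(* A stage (X_n, e_n, Y_n) of the construction of e : S -> F. *)
Record approximation := Approximation {
  appr_dom : set S;
  appr_fun : S -> F;
  appr_cod : set F;
  appr_dom_fg : fg_set appr_dom;
  appr_dom_neq0 : appr_dom !=set0;
  appr_cod_fg : fg_set appr_cod;
  appr_emb : embedding_on appr_dom appr_fun;
  appr_sub : forall x, appr_dom x -> appr_cod (appr_fun x) }.

Definition partial_solution (phi : hom S F) (a : approximation) (psi : F -> F) :=
  hom_on (appr_cod a) psi /\ forall x, appr_dom a x -> psi (appr_fun a x) = phi x.

(** The last clause is uniform in [phi]: the chain of stages is fixed before any [phi] is given, yet
    every partial solution has to extend along it. *)
Definition refines (a b : approximation) :=
  [/\ forall x, appr_dom a x -> appr_dom b x /\ appr_fun b x = appr_fun a x,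
      appr_cod a `<=` appr_cod b
    & forall phi psi, partial_solution phi a psi ->
      exists psi', partial_solution phi b psi' /\
        forall y, appr_cod a y -> psi' y = psi y].

(** X_0 is generated by one point and Y_0 is its image under an embedding in [F]; on Y_0 the
    solution is [phi] after the inverse of that embedding. *)
Lemma approximation_start : exists a : approximation,
  forall phi : hom S F, exists psi, partial_solution phi a psi.
Proof.
have [s _] := carrier_neq0 S.
have X0 : generated [set s] !=set0 by exists s; exact: sub_gen_smallest.
pose U := Substructure X0 (@generated_closed _ _ [set s]).
have Ufg : fg_set U by exists [set s]; split.
have [h hemb] := limit_embedding (closure_class_fg hS Ufg).
have [e [_ eE /(_ hemb) eemb]] := hom_extend_on h.
have Yfg : fg_set (range h) by apply: fg_range; exact: fg_set_fin_gen.
have eY x : members U x -> range h (e x).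
  by move=> Ux; exists (exist _ x Ux) => //; rewrite -eE.
exists (Approximation Ufg X0 Yfg eemb eY) => phi.
have [p [_ _ pE]] := embedding_inverse hemb.
have [psi [psiY psiE _]] := hom_extend_on (hom_comp phi (hom_comp (incl U) p)).
exists psi; split=> //= x Ux; pose u : induced U := exist _ x Ux.
have hu : members (hom_range h) (h u) by exists u.
have -> : e x = h u by rewrite -eE.
by rewrite (psiE (exist _ _ hu)) /= (pE _ u).
Qed.

(* The free sum of [appr_cod a] and S over [appr_dom a] has a finitely generated
   part that contains [appr_cod a] and s; it is embedded in F over
   [appr_cod a]. Freeness is what lets a partial solution agree with [phi] on
   the new points of S. *)
Lemma approximation_step (a : approximation) (s : S) (y : F) :
  exists b, [/\ refines a b, appr_dom b s & appr_cod b y].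
Proof.
case: a => X e Y Xfg X0 Yfg eemb eXY.
pose U := Substructure X0 (fg_set_closed Xfg).
have Y0 : Y !=set0 by have [x /eXY] := X0; exists (e x).
pose V := Substructure Y0 (fg_set_closed Yfg).
have [eX eI eR] := eemb.
have [e1 e1E] := hom_on_restrict (U := U) eX.
have e1V u : members V (e1 u) by rewrite e1E; exact: eXY (svalP u).
have e1emb : is_embedding e1.
  split=> [u v|r x].
    rewrite !e1E => uv; apply: (incl_embedding U).1.
    by apply: eI uv; exact: svalP.
  have -> : e1 \o x = e \o (sval \o x) by apply/funext => i; exact: e1E.
  by apply: eR => i; exact: svalP.
have [f1 [f1E /(_ e1emb) f1emb]] := hom_corestrict e1V.
have CU : C (induced U) by exact: (closure_class_fg (U := U) hS Xfg).
have CV : C (induced V) by exact: limit_fg.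
have cF : countable [set: F] by case: hF.
have [P [i1 [i2 [[i1emb i2emb i12 univ] hP]]]] :=
  hdag CU (class_closure CV (induced_countable V cF)) hS f1emb (incl_embedding U).
have [GV [GVfin genV]] := fg_set_fin_gen (U := V) Yfg.
have [GX [GXfin genX]] := Xfg.
pose X' := generated (X `|` [set s]).
(* Finitely many generators of [Y] and of [X'] suffice for the part [Q] of the free sum that is to
   be embedded in [F]. *)
pose GQ := i1 @` GV `|` i2 @` (GX `|` [set s]).
have i1Q v : generated GQ (i1 v).
  have : [set: induced V] v by [].
  rewrite -genV; move: v; apply: generated_hom; first exact: generated_closed.
  by move=> v Gv; apply: sub_gen_smallest; left; exists v.
have i2GQ x : (GX `|` [set s]) x -> generated GQ (i2 x).
  by move=> Gx; apply: sub_gen_smallest; right; exists x.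
have i2Q x : X' x -> generated GQ (i2 x).
  move: x; apply: generated_hom; first exact: generated_closed.
  move=> x [|->]; last by apply: i2GQ; right.
  rewrite genX; move: x; apply: generated_hom; first exact: generated_closed.
  by move=> x Gx; apply: i2GQ; left.
have [v0 _] := carrier_neq0 (induced V).
have Q0 : generated GQ !=set0 by exists (i1 v0).
pose Q := Substructure Q0 (@generated_closed _ _ GQ).
have Qfg : fg_set Q.
  exists GQ; split=> //; rewrite finite_setU; split; first exact: finite_image.
  by apply: finite_image; rewrite finite_setU.
have CQ : C (induced Q) := closure_class_fg (U := Q) hP Qfg.
have [j [jE /(_ i1emb) jemb]] := hom_corestrict (V := Q) i1Q.
(* [k] is the identity on the copy of [Y]; as the free sum commutes over [X], the new map [e'] then
   extends [e]. *)
have [k [kemb kE]] := limit_extension (U := V) Yfg CQ jemb.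
have [k' [_ k'E /(_ kemb) [[k'F k'R] k'I k'R']]] := hom_extend_on k.
have k'i1 v : k' (i1 v) = sval v by rewrite -jE k'E kE.
pose e' := k' \o i2.
have e'e x : X x -> e' x = e x.
  move=> Xx; pose u : induced U := exist _ x Xx.
  by have := i12 u; rewrite /e' /= => <-; rewrite k'i1 f1E e1E.
have e'emb : embedding_on X' e'.
  split; first split.
  - by move=> f x Xx; rewrite /e' /= hom_fint k'F // => i; exact: i2Q.
  - move=> r x Xx /(hom_rint i2); apply: (k'R r (i2 \o x)) => i; exact: i2Q.
  - by move=> x x' Xx Xx' /(k'I _ _ (i2Q _ Xx) (i2Q _ Xx'))/i2emb.1.
  - move=> r x Xx /(k'R' r (i2 \o x)) Rx; apply: i2emb.2; apply: Rx => i; exact: i2Q.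
have Kfg : fg_set (range k) by apply: fg_range; exact: fg_set_fin_gen.
(* Adding [y] lets the codomains exhaust [F] in the end. *)
pose Y' := generated (range k `|` [set y]).
have kY' q : Y' (k q) by apply: sub_gen_smallest; left; exists q.
have e'Y' x : X' x -> Y' (e' x).
  by move=> /i2Q Qx; rewrite /e' /= (k'E (exist _ _ Qx)).
have XX' x : X x -> X' x by move=> Xx; apply: sub_gen_smallest; left.
have X'0 : X' !=set0 by have [x /XX'] := X0; exists x.
exists (Approximation (fg_setU1 s Xfg) X'0 (fg_setU1 y Kfg) e'emb e'Y').
split; [split=> /=|by apply: sub_gen_smallest; right..].
- by move=> x Xx; split; [exact: XX'|exact: e'e].
- by move=> z Yz; have := kY' (j (exist _ z Yz)); rewrite kE.
move=> phi psi [/= psiY psie].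
have [psi1 psi1E] := hom_on_restrict (U := V) psiY.
(* [psi] on [Y] and [phi] on [S] agree over [X], so both come from one [h] on the free sum. Its
   restriction to [Q] is moved to [range k] and then extended to [y]. *)
have agree : psi1 \o f1 =1 phi \o incl U.
  by move=> u /=; rewrite psi1E f1E e1E psie //; exact: svalP.
have [h [[h1 h2] _]] := univ F limit_closure psi1 phi agree.
have [p [_ _ pE]] := embedding_inverse kemb.
have [psi0 [psi0K psi0E _]] := hom_extend_on (hom_comp h (hom_comp (incl Q) p)).
have psi0k q : psi0 (k q) = h (sval q).
  have kq : members (hom_range k) (k q) by exists q.
  by rewrite (psi0E (exist _ _ kq)) /= (pE _ q).
have [psi' [psi'Y psi'E]] := hom_extend_point h1p y Kfg (range_neq0 k) psi0K.
have psi'k q : psi' (k q) = h (sval q) by rewrite psi'E ?psi0k //; exists q.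
exists psi'; split; first split=> //.
  move=> x /i2Q Qx; rewrite /= /e' /= (k'E (exist _ _ Qx)) psi'k /=.
  exact: h2.
move=> z Yz; pose v : induced V := exist _ z Yz.
have -> : z = k (j v) by rewrite kE.
by rewrite psi'k jE; have /= -> := h1 v; rewrite psi1E kE.
Qed.

Lemma free_extension : exists e : hom S F, forall phi : hom S F,
  exists psi : hom F F, forall x, psi (e x) = phi x.
Proof.
have [cS _] := hS; have [cF _ _ _] := hF.
have [enS enSE] := countable_surj cS (carrier_neq0 S).
have [enF enFE] := countable_surj cF (carrier_neq0 F).
have [a0 start] := approximation_start.
(* A stage is paired with its index, which selects the next points of [S] and [F] to absorb. *)
have /choice[next nextE] (na : nat * approximation) : exists nb : nat * approximation,
    [/\ nb.1 = na.1.+1, refines na.2 nb.2, appr_dom nb.2 (enS na.1) &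
      appr_cod nb.2 (enF na.1)].
  by have [b [? ? ?]] := approximation_step na.2 (enS na.1) (enF na.1); exists (na.1.+1, b).
pose na n := iter n next (0, a0); pose a n := (na n).2.
have na1 n : (na n).1 = n by elim: n => //= n IH; have [-> _ _ _] := nextE (na n); rewrite IH.
have aS n : [/\ refines (a n) (a n.+1), appr_dom (a n.+1) (enS n) &
    appr_cod (a n.+1) (enF n)].
  by have [_] := nextE (na n); rewrite na1.
have dom_mono m n x : m <= n -> appr_dom (a m) x ->
    appr_dom (a n) x /\ appr_fun (a n) x = appr_fun (a m) x.
  move=> /subnK<-; elim: (n - m) => // k IH /IH[Dx <-]; rewrite addSn.
  by have [[ref _ _] _ _] := aS (k + m); exact: ref.
have cod_mono m n : m <= n -> appr_cod (a m) `<=` appr_cod (a n).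
  move=> /subnK<-; elim: (n - m) => // k IH y /IH Cy; rewrite addSn.
  by have [[_ ref _] _ _] := aS (k + m); exact: ref.
have /choice[N NE] x : exists n, appr_dom (a n) x.
  by have [n _ <-] := enSE x I; exists n.+1; have [] := aS n.
have /choice[M ME] y : exists n, appr_cod (a n) y.
  by have [n _ <-] := enFE y I; exists n.+1; have [] := aS n.
pose e x := appr_fun (a (N x)) x.
have eE n x : appr_dom (a n) x -> e x = appr_fun (a n) x.
  move=> Dx; rewrite /e; have [_ <-] := dom_mono _ _ _ (leq_maxl (N x) n) (NE x).
  by have [_ <-] := dom_mono _ _ _ (leq_maxr (N x) n) Dx.
(* Arities are finite, so each tuple lies in a single stage, where operations and relations can be
   checked. *)
have bounded k (x : 'I_k -> S) : exists n, forall i, appr_dom (a n) (x i).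
  exists (\max_i N (x i)) => i.
  have Ni := leq_bigmax (F := fun i => N (x i)) i.
  by have [] := dom_mono _ _ _ Ni (NE (x i)).
have boundedF k (y : 'I_k -> F) : exists n, forall i, appr_cod (a n) (y i).
  exists (\max_i M (y i)) => i.
  have Mi := leq_bigmax (F := fun i => M (y i)) i.
  exact: cod_mono Mi _ (ME (y i)).
have eF f x : e (fint S f x) = fint F f (e \o x).
  have [n Dx] := bounded _ x; have [[funF _] _ _] := appr_emb (a n).
  rewrite (eE n) ?funF //; last exact: (fg_set_closed (appr_dom_fg (a n))).
  by congr fint; apply/funext => i /=; rewrite (eE n).
have eR r x : rint S r x -> rint F r (e \o x).
  move=> Rx; have [n Dx] := bounded _ x; have [[_ funR] _ _] := appr_emb (a n).
  have -> : e \o x = appr_fun (a n) \o x by apply/funext => i /=; rewrite (eE n).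
  exact: funR.
exists (Hom eF eR) => phi; have [psi0 psi0E] := start phi.
(* The condition on [np.2] sits under the existential, so that [up] is total; away from partial
   solutions its value is arbitrary. *)
have /choice[up upE] (np : nat * (F -> F)) : exists psi',
    partial_solution phi (a np.1) np.2 ->
    partial_solution phi (a np.1.+1) psi' /\
    forall y, appr_cod (a np.1) y -> psi' y = np.2 y.
  have [sol|] := pselect (partial_solution phi (a np.1) np.2); last by exists np.2.
  by have [[_ _ /(_ _ _ sol)[psi' ?]] _ _] := aS np.1; exists psi'.
pose psi_ := fix psi n := if n is m.+1 then up (m, psi m) else psi0.
have psi_sol n : partial_solution phi (a n) (psi_ n).
  by elim: n => //= n IH; have [] := upE (n, psi_ n) IH.
have psi_mono m n y : m <= n -> appr_cod (a m) y -> psi_ n y = psi_ m y.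
  move=> /subnK<- Cy; elim: (n - m) => // k <-; rewrite addSn /=.
  have [_] := upE (k + m, psi_ (k + m)) (psi_sol _); apply => /=.
  exact: cod_mono (leq_addl _ _) _ Cy.
pose psi y := psi_ (M y) y.
have psiE n y : appr_cod (a n) y -> psi y = psi_ n y.
  move=> Cy; rewrite -(psi_mono _ _ _ (leq_maxr (M y) n) Cy).
  by rewrite (psi_mono _ _ _ (leq_maxl (M y) n)).
have psiF f y : psi (fint F f y) = fint F f (psi \o y).
  have [n Cy] := boundedF _ y; have [[solF _] _] := psi_sol n.
  rewrite (psiE n) ?solF //; last exact: (fg_set_closed (appr_cod_fg (a n))).
  by congr fint; apply/funext => i /=; rewrite (psiE n).
have psiR r y : rint F r y -> rint F r (psi \o y).
  move=> Ry; have [n Cy] := boundedF _ y; have [[_ solR] _] := psi_sol n.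
  have -> : psi \o y = psi_ n \o y by apply/funext => i /=; rewrite (psiE n).
  exact: solR.
exists (Hom psiF psiR) => x /=.
have Dx := NE x; have [_ sol] := psi_sol (N x).
by rewrite (psiE (N x)) ?sol //; exact: appr_sub.
Qed.

End FreeExtension.
End FraisseLimit.

(** * Endomorphisms of the limit as words in three letters *)

Theorem theorem4p2 (L : signature) (C : structure L -> Prop) (F : structure L)
    (hC : fraisse_class C) (hdag : dagger C) (h1p : one_point_hom_ext C)
    (hF : fraisse_limit C F)
    (hcop : exists (S : structure L) (iota : nat -> hom F S),
        is_coproduct C iota) :
  strongly_distorted (End F) /\
  (exists n : nat, is_sierpinski_rank (End F) n /\ n <= 3) /\
  (~ sg_fin_gen (End F) -> bergman (End F)).
Proof.
have [S [iota [hS _ copr]]] := hcop.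
have [e ext] := free_extension hC hF hdag h1p hS.
have [sigma [sigmaE _]] := copr S hS (fun n => iota n.+1).
have [shift shiftE] := ext (hom_comp e sigma).
(* Letters 2, 1 and 0 stand for [beta], [shift] and [alpha]. The words do not depend on the sequence
   [a]. *)
pose w n : word 'I_3 := (ord_max, rcons (nseq n (inord 1)) ord0).
have words (a : nat -> End F) : exists s : 'I_3 -> End F,
    forall n, a n = word_eval s (w n).
  have [fold [foldE _]] := copr F (limit_closure hF) a.
  have [beta betaE] := ext fold.
  pose alpha : End F := hom_comp e (iota 0).
  (* [beta] is the default value of [nth], hence the value at index 2. *)
  pose s (i : 'I_3) : End F := nth beta [:: alpha; (shift : End F)] i.
  (* Each [shift] raises the index of the copy by one; [b] and [m] vary in the induction. *)
  have runE (b : End F) k m x :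
      foldl (fun r i => (r * s i)%g) b (nseq k (inord 1)) (e (iota m x)) =
      b (e (iota (k + m) x)).
    elim: k b m => //= k IH b m.
    by rewrite IH /s inordK //= shiftE /= [sigma _]sigmaE.
  exists s => n; rewrite /word_eval foldl_rcons.
  apply: hom_ext => x; rewrite -foldE /= -betaE.
  by rewrite runE addn0.
have dist : strongly_distorted (End F).
  exists (fun n => n.+2), 3 => a; have [s sE] := words a.
  by exists s, w => n; rewrite /word_length /= size_rcons size_nseq.
split=> //; split; last by move=> _; exact: strongly_distorted_bergman.
apply: sierpinski_rank_le => //; apply: covers_countable_words; first exact: end_one.
by move=> a; have [s sE] := words a; exists s, w.
Qed.
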